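(* Let $(V,p,e)$ be a hyperbolic system of degree $n$ in which there exists a finite family $c_1,c_2,\ldots,c_k$ of elements of $\Lambda_+$ such that each $c_i$ is of rank one and $c_1+c_2+\cdots+c_k\in\Lambda_{++}$. Then $p$ is minimal. Moreover, when $n\ge 2$, the derivative polynomial $p'$ is minimal and $\Lambda_+$ is strictly contained in $\Lambda_+'$.
   Context: Let $V$ be a finite-dimensional real vector space and $e\in V$ nonzero. A homogeneous polynomial $p$ of degree $n\ge 1$ on $V$ is hyperbolic in the direction $e$ if $p(e)\ne 0$ and for every $x\in V$ the univariate polynomial $t\mapsto p(te-x)$ has only real zeros; then $(V,p,e)$ is called a hyperbolic system of degree $n$. The eigenvalue map $\lambda:V\to\mathbb{R}^n$ sends $x$ to the vector $\lambda(x)=(\lambda_1(x),\ldots,\lambda_n(x))^T$ of roots of $t\mapsto p(te-x)$, with multiplicity, in decreasing order. The hyperbolicity cone is $\Lambda_+=\{x\in V:\lambda(x)\ge 0\}$ and its interior is $\Lambda_{++}=\{x\in V:\lambda(x)>0\}$ (entrywise inequalities). An element $c\in V$ is of rank one if $\lambda(c)$ has exactly one nonzero entry (counted with multiplicity). The derivative polynomial is $p'(x)=\frac{d}{dt}p(te+x)\big|_{t=0}$; for $n\ge 2$, $(V,p',e)$ is a hyperbolic system of degree $n-1$, whose hyperbolicity cone is denoted $\Lambda_+'$ and contains $\Lambda_+$. For a hyperbolic system $(V,p,e)$, the polynomial $p$ is called minimal if it has the lowest degree among all polynomials on $V$ that are hyperbolic in the direction $e$ and whose hyperbolicity cone (in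 the direction $e$) is $\Lambda_+$; minimality of $p'$ is meant in the system $(V,p',e)$, i.e. with respect to the cone $\Lambda_+'$. *)

(* Defs.v *)
From mathcomp Require Export all_boot all_order all_algebra.
From mathcomp Require Export classical_sets reals.
From mathcomp Require Export complex polyorder polyrcf.
From mathcomp Require Export mpoly.

Set Implicit Arguments.
Unset Strict Implicit.
Unset Printing Implicit Defensive.

Import Order.TTheory GRing.Theory Num.Theory.

Local Open Scope ring_scope.
Local Open Scope classical_set_scope.

Section Hyperbolic.
Context {R : realType} {V : vectType R}.

(* A polynomial on V is a polynomial in the coordinates with respect to the
   fixed basis [vbasis {:V}]; hyperbolicity, cones and degrees do not depend
   on which basis is used. *)
Implicit Types (p q : {mpoly R[\dim {:V}]}) (e x u v : V).

Definition vcoord x : 'I_(\dim {:V}) -> R :=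
  fun i => coord (vbasis {:V}) i x.

Definition pval p x : R := p.@[vcoord x].

(* The univariate polynomial t |-> p (t u + v). *)
Definition pline p u v : {poly R} :=
  mmap (@polyC R) (fun i => vcoord u i *: 'X + (vcoord v i)%:P) p.

Lemma horner_pline p u v t : (pline p u v).[t] = pval p (t *: u + v).
Proof.
rewrite /pline /pval /meval /mmap -horner_evalE raddf_sum /=.
apply: eq_bigr => m _; rewrite horner_evalE hornerM hornerC; congr (_ * _).
rewrite /mmap1 -horner_evalE rmorph_prod /=; apply: eq_bigr => i _.
rewrite rmorphXn /= horner_evalE !hornerE; congr (_ ^+ _).
by rewrite /vcoord linearP /= mulrC.
Qed.

(* All complex zeros are real. *)
Definition only_real_zeros (f : {poly R}) : Prop :=
  forall z : R[i], root (map_poly (real_complex R) f) z -> z \is Num.real.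

Definition hyperbolic (n : nat) p e : Prop :=
  [/\ e != 0, (0 < n)%N, p \is n.-homog, pval p e != 0
    & forall x, only_real_zeros (pline p e (- x))].

(* [rootsR f] lists the distinct real roots of f. *)
Definition sorted_roots (f : {poly R}) : seq R :=
  sort >=%R (flatten [seq nseq (\mu_a f) a | a <- rootsR f]).

(* When p is hyperbolic of degree n, the list of roots has exactly n entries
   and the default value of [nth] is never used. *)
Definition eigenvalue_map (n : nat) p e x : 'cV[R]_n :=
  \col_(i < n) nth 0 (sorted_roots (pline p e (- x))) i.

Definition hyp_cone (n : nat) p e : set V :=
  [set x | forall i, 0 <= eigenvalue_map n p e x i 0].

Definition hyp_cone_int (n : nat) p e : set V :=
  [set x | forall i, 0 < eigenvalue_map n p e x i 0].

Definition rank_one (n : nat) p e x : Prop :=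
  #|[set i : 'I_n | eigenvalue_map n p e x i 0 != 0]%SET| = 1%N.

(* The derivative at t = 0 of p (t e + X), with X the generic point of V. *)
Definition deriv_poly p e : {mpoly R[\dim {:V}]} :=
  (mmap (fun a : R => (a%:MP)%:P)
        (fun i => (vcoord e i)%:MP *: 'X + ('X_i)%:P) p)^`().[0].

Lemma pval_deriv_poly p e x :
  pval (deriv_poly p e) x = (pline p e x)^`().[0].
Proof.
rewrite /deriv_poly /pval -[in LHS](horner_map (meval (vcoord x))) /= rmorph0.
rewrite -deriv_map; congr (_^`().[0]).
rewrite /pline /mmap raddf_sum /=; apply: eq_bigr => m _.
rewrite rmorphM /= map_polyC /= mevalC; congr (_ * _).
rewrite /mmap1 rmorph_prod /=; apply: eq_bigr => i _.
rewrite rmorphXn /= rmorphD /= map_polyZ /= map_polyX map_polyC /= mevalC.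
by rewrite mevalXU.
Qed.

Definition minimal_poly (n : nat) p e : Prop :=
  hyperbolic n p e /\
  forall m q, hyperbolic m q e -> hyp_cone m q e = hyp_cone n p e ->
    (n <= m)%N.

End Hyperbolic.

(* Main.v *)
Require Import Defs.
From mathcomp Require Import boolp ring lra zify.

(** Write K for the hyperbolicity cone of p and mult x for the multiplicity of 0
    as an eigenvalue of x, that is, the order of vanishing of t |-> p (t e + x)
    at t = 0.  On K the multiplicity is controlled by the order structure of the
    cone alone, in three ways:

    - adding an element of K never raises it ([mult_mono]);
    - if adding y in K leaves the multiplicity of x unchanged, then x - s y is
      still in K for some s > 0 ([same_mult_interior]), i.e. x + y lies in no
      larger face than x;
    - adding a rank-one element lowers it by at most 1 ([mult_rank_one_step]).

    Let q of degree m have the same cone as p, and add the c_i one after the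
    other, starting from 0.  The p-multiplicity goes from n to 0 in steps of at
    most 1, so it drops at n of the stages.  At each of these the q-multiplicity
    drops as well: otherwise x - s c would be in K, and x would be, up to a
    positive factor, the sum of x + c and an element of K, so that the
    p-multiplicity would not drop either.  The q-multiplicity starts at m, hence
    n <= m ([degree_le_of_chain]).  In other words, the degree of any polynomial
    defining K is at least the length of a chain of faces of K, and the rank-one
    elements produce a chain of length n.

    The same chain handles p'.  For x in K the polynomial t |-> p'(t e + x) is the
    derivative of the real-rooted t |-> p (t e + x), so the p'-multiplicity of x is
    mult x - 1, truncated at 0 ([mult_deriv]); it therefore decreases from n - 1
    to 0 in steps of at most 1 along the same partial sums.  The inclusion
    of K in the cone of p' is strict because otherwise p' would define K in degree
    n - 1, against the minimality of p.

    The facts about multiplicities rest on one positivity statement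
    ([coef_pline_ge0]): if p e > 0, then for y, z in K all coefficients of
    w |-> p (z + w y) are nonnegative.  This contains the convexity of K
    ([cone_add]) and the monotonicity of p along K ([pval_cone_mono]), from which
    multiplicities are compared by squeezing one polynomial below another
    ([dvdXn_squeeze]).  Positivity holds because, for y in the interior of K,
    the zeros of w |-> p (z + w y) are real and nonpositive.  Both facts follow
    by moving to the given polynomial from one whose zeros are known, through
    polynomials without zeros on the boundary of a half-plane: by continuity no
    zero can enter it ([root_half_plane_homotopy]). *)

Set Implicit Arguments.
Unset Strict Implicit.
Unset Printing Implicit Defensive.

Import Order.TTheory GRing.Theory Num.Theory.

Local Open Scope ring_scope.
Local Open Scope classical_set_scope.

(** * Continuity of roots and a homotopy principle for half-planes *)

Section RootContinuity.
Context {R : realType}.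
Local Notation C := R[i].
Local Notation Im := (@complex.Im R).
Local Notation Re := (@complex.Re R).
Local Notation "x %:C" := (real_complex R x).

Lemma complex_Im_le_norm (z : C) : (`|Im z|)%:C <= `|z|.
Proof.
have ni : `|'i%C : C| = 1.
  by rewrite normc_def /= expr0n /= add0r expr1n sqrtr1.
rewrite -[leRHS]mulr1 -ni -normrM.
by have := normc_ge_Re (z * 'i%C); rewrite ReiNIm normrN.
Qed.

Lemma complex_pos_Re (z : C) : 0 < z -> z = (Re z)%:C /\ 0 < Re z.
Proof.
move=> z0; have zr : z \is Num.real by rewrite realE ltW.
by split; [rewrite RRe_real|move: z0; rewrite ltcE => /andP[]].
Qed.

Lemma horner_norm_le (K : numDomainType) (q : {poly K}) (b B : K) :
  `|b| <= B -> `|q.[b]| <= \sum_(i < size q) `|q`_i| * B ^+ i.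
Proof.
move=> bB; rewrite horner_coef (le_trans (ler_norm_sum _ _ _)) //.
apply: ler_sum => i _; rewrite normrM normrX ler_wpM2l //.
by apply: lerXn2r => //; rewrite nnegrE // (le_trans _ bB).
Qed.

Lemma horner_continuous (q : {poly C}) (a : R) (eps : C) : 0 < eps ->
  exists2 eta : R, 0 < eta &
    forall b : R, `|b - a| < eta -> `|q.[b%:C] - q.[a%:C]| < eps.
Proof.
move=> eps0.
have /factor_theorem[h hE] : root (q - q.[a%:C]%:P) a%:C.
  by rewrite /root !hornerE subrr.
pose M := \sum_(i < size h) `|h`_i| * (`|a%:C| + 1) ^+ i.
have M0 : 0 <= M.
  by apply: sumr_ge0 => i _; rewrite mulr_ge0 // exprn_ge0 // addr_ge0.
have D0 : 0 < M + 1 + eps by rewrite addr_gt0 // ltr_wpDl.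
have [etaE eta0] := complex_pos_Re (divr_gt0 eps0 D0).
exists (Re (eps / (M + 1 + eps))) => // b.
rewrite -ltcR -etaE => ab.
have nE : (`|b - a|)%:C = `|b%:C - a%:C|.
  by rewrite -rmorphB normc_def /= expr0n /= addr0 sqrtr_sqr.
rewrite nE in ab.
have -> : q.[b%:C] - q.[a%:C] = h.[b%:C] * (b%:C - a%:C).
  by have := congr1 (horner^~ b%:C) hE; rewrite !hornerE.
have hM : `|h.[b%:C]| <= M.
  apply: horner_norm_le; rewrite -lerBlDl (le_trans (lerB_dist _ _)) //.
  rewrite (le_trans (ltW ab)) // ler_pdivrMr // mul1r lerDr addr_ge0 //.
rewrite normrM (le_lt_trans (ler_wpM2r _ hM)) //.
rewrite (le_lt_trans (ler_wpM2l M0 (ltW ab))) // mulrA ltr_pdivrMr //.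
by rewrite [M * _]mulrC ltr_pM2l // -addrA ltrDl addr_gt0.
Qed.

Lemma common_radius (k : nat) (P : nat -> R -> Prop) (a : R) :
  (forall i, exists2 eta : R, 0 < eta & forall b, `|b - a| < eta -> P i b) ->
  exists2 eta : R, 0 < eta &
    forall b, `|b - a| < eta -> forall i, (i < k)%N -> P i b.
Proof.
move=> H; elim: k => [|k [e1 e10 H1]]; first by exists 1.
have [e2 e20 H2] := H k; exists (Num.min e1 e2) => [|b].
  by rewrite lt_min e10.
rewrite lt_min => /andP[b1 b2] i; rewrite ltnS leq_eqVlt => /predU1P[->|].
  exact: H2.
exact: H1.
Qed.

(** The value of [f] at [z] is its leading coefficient times the product of the
    distances to the roots, so if all distances were at least [eps] it could not
    be small. *)
Lemma root_near_small_value (f : {poly C}) (z eps : C) :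
  f != 0 -> 0 < eps -> `|f.[z]| < `|lead_coef f| * eps ^+ (size f).-1 ->
  exists2 r, root f r & `|z - r| < eps.
Proof.
move=> f0 eps0; have [rs fE] := closed_field_poly_normal f.
have lf0 : lead_coef f != 0 by rewrite lead_coef_eq0.
have szE : (size f).-1 = size rs.
  by rewrite fE size_scale // size_prod_XsubC.
have inrs r : r \in rs -> root f r.
  by move=> rr; rewrite fE rootZ // root_prod_XsubC.
rewrite szE {1}fE hornerZ normrM ltr_pM2l ?normr_gt0 // horner_prod.
move: inrs; clear -eps0; elim: rs => [|r rs IH] inrs.
  by rewrite big_nil normr1 expr0 ltxx.
rewrite big_cons normrM exprS !hornerE => H.
have [zr|zr] := real_ltP (normr_real (z - r)) (gtr0_real eps0).
  by exists r => //; apply: inrs; rewrite mem_head.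
apply: IH => [s ss|]; first by apply: inrs; rewrite inE ss orbT.
rewrite -(ltr_pM2l eps0) (le_lt_trans _ H) // ler_wpM2r //.
Qed.

(** A one-parameter family of polynomials is a polynomial in the root variable
    with coefficients polynomial in the parameter; this is its member at [b]. *)
Definition fibre (F : {poly {poly C}}) (b : C) : {poly C} :=
  map_poly (horner_eval b) F.

Lemma coef_fibre F b i : (fibre F b)`_i = (F`_i).[b].
Proof. by rewrite coef_map. Qed.

Lemma horner_fibre F b z : (fibre F b).[z] = F.[z%:P].[b].
Proof. by rewrite -[RHS]horner_evalE -horner_map /= horner_evalE hornerC. Qed.

Section Family.
Variables (n : nat) (c : C) (F : {poly {poly C}}).
Hypotheses (c0 : c != 0) (szF : (size F <= n.+1)%N) (cF : F`_n = c%:P).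

Lemma size_fibre b : size (fibre F b) = n.+1.
Proof.
apply/eqP; rewrite eqn_leq (leq_trans (size_poly _ _)) //=.
rewrite ltnNge; apply: contra c0 => sz.
by rewrite -[c](hornerC c b) -cF -coef_fibre nth_default.
Qed.

Lemma lead_coef_fibre b : lead_coef (fibre F b) = c.
Proof. by rewrite lead_coefE size_fibre /= coef_fibre cF hornerC. Qed.

Lemma fibre_neq0 b : fibre F b != 0.
Proof. by rewrite -size_poly_eq0 size_fibre. Qed.

(** The nearby members are small at [r], and [root_near_small_value] applies to
    each of them with the same leading coefficient. *)
Lemma fibre_root_stable (a : R) (r eps : C) : 0 < eps ->
  root (fibre F a%:C) r ->
  exists2 eta : R, 0 < eta & forall b : R, `|b - a| < eta ->
    exists2 s, root (fibre F b%:C) s & `|r - s| < eps.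
Proof.
move=> eps0 /rootP; rewrite horner_fibre => ra.
have d0 : 0 < `|c| * eps ^+ n by rewrite mulr_gt0 ?normr_gt0 // exprn_gt0.
have [eta eta0 H] := horner_continuous F.[r%:P] a d0.
exists eta => // b /H; rewrite ra subr0 => rb.
apply: root_near_small_value => //; first exact: fibre_neq0.
by rewrite lead_coef_fibre size_fibre horner_fibre.
Qed.

(** The converse of [fibre_root_stable], uniform over all roots of the nearby
    member, which a priori could escape to infinity.  Comparing the value of the
    limit member at such a root [s] with (1 + |s|) ^ n, instead of a constant,
    gives a root within (1 + |s|) / L of [s], and [L] is chosen so that this
    forces |s - r| < eps. *)
Lemma fibre_root_specialize (a : R) (eps : C) : 0 < eps ->
  exists2 eta : R, 0 < eta & forall b : R, `|b - a| < eta ->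
    forall s, root (fibre F b%:C) s ->
    exists2 r, root (fibre F a%:C) r & `|s - r| < eps.
Proof.
set f := fibre F a%:C => eps0.
have [rs fE] := closed_field_poly_normal f.
have f0 : f != 0 by exact: fibre_neq0.
pose rho := \sum_(r <- rs) `|r|.
have rho0 : 0 <= rho by exact: sumr_ge0.
have rhoP r : root f r -> `|r| <= rho.
  rewrite fE rootZ ?lead_coef_eq0 // root_prod_XsubC => rr.
  by rewrite /rho (big_rem r) //= lerDl sumr_ge0.
have rho1 : 0 < rho + 1 by rewrite ltr_wpDl.
pose L := 1 + (rho + 1) / eps.
have L0 : 0 < L by rewrite addr_gt0 // divr_gt0.
(* [n.+2] rather than [n.+1], the number of coefficients, for a strict bound *)
pose delta := `|c| / (L ^+ n * n.+2%:R).
have d0 : 0 < delta.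
  by rewrite divr_gt0 ?normr_gt0 // mulr_gt0 ?exprn_gt0 // ltr0n.
have [eta eta0 H] := common_radius n.+1
  (fun i => horner_continuous F`_i a d0).
exists eta => // b /H{}H s /rootP sb.
pose T := 1 + `|s|; have T1 : 1 <= T by rewrite lerDl.
have T0 : 0 < T by rewrite (lt_le_trans ltr01).
have [r rf sr] : exists2 r, root f r & `|s - r| < T / L.
  apply: root_near_small_value => //; first by rewrite divr_gt0.
  rewrite lead_coef_fibre size_fibre /= -[f.[s]]subr0 -sb.
  rewrite !(@horner_coef_wide _ n.+1) ?size_fibre // -sumrB.
  rewrite (le_lt_trans (ler_norm_sum _ _ _)) //.
  apply: (@le_lt_trans _ _ (\sum_(i < n.+1) delta * T ^+ n)).
    apply: ler_sum => i _; rewrite -mulrBl normrM ler_pM //.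
      by rewrite !coef_fibre distrC ltW // H.
    rewrite normrX (@le_trans _ _ (T ^+ i)) //.
      by apply: lerXn2r; rewrite ?nnegrE ?lerDr // ltW.
    by rewrite ler_weXn2l // -ltnS.
  rewrite sumr_const card_ord -mulr_natr expr_div_n.
  have -> : delta * T ^+ n * n.+1%:R =
    `|c| * (T ^+ n / L ^+ n) * (n.+1%:R / n.+2%:R).
    rewrite /delta invfM; ring.
  rewrite gtr_pMr ?ltr_pdivrMr ?mul1r ?ltr_nat ?ltr0n //.
  by rewrite mulr_gt0 ?normr_gt0 // divr_gt0 // exprn_gt0.
exists r => //; rewrite ltr_pdivlMr // /L mulrDr mulr1 in sr.
have sT : T <= rho + 1 + `|s - r|.
  rewrite /T [rho + 1]addrC -addrA lerD2l.
  have := ler_normD (s - r) r; rewrite subrK => /le_trans -> //.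
  by rewrite [leRHS]addrC lerD2l rhoP.
have := lt_le_trans sr sT; rewrite addrC ltrD2r mulrA ltr_pdivrMr //.
by rewrite mulrC ltr_pM2l.
Qed.

(** Roots cannot enter the upper half-plane without crossing the real axis: for
    parameters below 1, having a root there is both an open and a closed
    condition.  The real axis may be touched at the final parameter 1, where only
    openness is used. *)
Lemma root_half_plane_homotopy :
  (forall b t : R, 0 <= b < 1 -> ~~ root (fibre F b%:C) t%:C) ->
  (forall z, 0 < Im z -> ~~ root (fibre F 0) z) ->
  forall z, 0 < Im z -> ~~ root (fibre F 1) z.
Proof.
move=> Hreal H0 z1 z1_gt0; apply/negP => rz1.
pose U (b : R) := exists2 z, root (fibre F b%:C) z & 0 < Im z.
have Im_lt (z w : C) (d : R) : `|z - w| < d%:C -> `|Im z - Im w| < d.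
  move=> zw; rewrite -ltcR (le_lt_trans _ zw) //.
  by have := complex_Im_le_norm (z - w); case: (z) (w) => [? ?] [].
have U_open a : U a ->
    exists2 eta : R, 0 < eta & forall b, `|b - a| < eta -> U b.
  case=> z rz z0; have [|eta eta0 H] := fibre_root_stable (eps := (Im z)%:C) _ rz.
    by rewrite ltcR.
  exists eta => // b /H[s rs /Im_lt zs]; exists s => //.
  by move: zs; rewrite ltr_norml => /andP[_]; rewrite ltrBlDr ltrDl.
have nU_open a : 0 <= a < 1 -> ~ U a ->
    exists2 eta : R, 0 < eta & forall b, `|b - a| < eta -> ~ U b.
  move=> a01 nUa.
  have neg z : root (fibre F a%:C) z -> Im z < 0.
    move=> rz; have [//|Iz|Iz] := ltgtP (Im z) 0; first by case: nUa; exists z.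
    move: (Hreal a (Re z) a01); suff -> : (Re z)%:C = z by rewrite rz.
    by case: z Iz {rz} => ? ? /= ->.
  have [d d0 dP] : exists2 d, 0 < d &
      forall z, root (fibre F a%:C) z -> Im z <= - d.
    have [rs fE] := closed_field_poly_normal (fibre F a%:C).
    have rootE z : root (fibre F a%:C) z = (z \in rs).
      by rewrite fE rootZ ?lead_coef_fibre // root_prod_XsubC.
    have: forall z, z \in rs -> Im z < 0 by move=> z; rewrite -rootE; apply: neg.
    suff: (forall z, z \in rs -> Im z < 0) -> exists2 d, 0 < d &
        forall z, z \in rs -> Im z <= - d.
      by move=> H /H[d d0 dP]; exists d => // z; rewrite rootE => /dP.
    elim: rs {fE rootE} => [|r rs IH] rsP; first by exists 1.
    have [|d d0 dP] := IH; first by move=> z zs; apply: rsP; rewrite inE zs orbT.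
    have r0 := rsP r (mem_head _ _).
    exists (Num.min d (- Im r)) => [|z]; first by rewrite lt_min d0 oppr_gt0.
    rewrite inE lerNr ge_min => /predU1P[->|/dP zd]; first by rewrite lexx orbT.
    by rewrite lerNr zd.
  have [|eta eta0 H] := fibre_root_specialize a (eps := d%:C); first by rewrite ltcR.
  exists eta => // b /H{}H [s /H[r /dP rd /Im_lt sr] s0].
  move: sr; rewrite ltr_norml => /andP[_]; rewrite ltNge => /negP[].
  by rewrite lerBrDr (le_trans _ (ltW s0)) // -lerBrDl sub0r.
pose S := [set b : R | 0 <= b <= 1 /\ U b].
have S1 : S 1 by split; [rewrite ler01 lexx|exists z1].
have Slb : lbound S 0 by move=> b [/andP[]].
have S_inf : has_inf S by split; [exists 1|exists 0].
pose a := inf S.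
have a0 : 0 <= a by apply: lb_le_inf => //; exists 1.
have a1 : a <= 1 by apply: ge_inf => //; exists 0.
have [Ua|nUa] := pselect (U a).
  have [eta eta0 H] := U_open a Ua.
  have a_gt0 : 0 < a.
    rewrite lt_neqAle a0 andbT; apply/eqP => a0E; case: Ua => z.
    by rewrite -a0E rmorph0 => rz z0; move: (H0 z z0); rewrite rz.
  have [b0 ba] : exists2 b, 0 <= b & (a - eta < b < a).
    exists (Num.max 0 (a - eta / 2)); first by rewrite le_max lexx.
    rewrite lt_max gt_max a_gt0 /= ltrD2l ltrN2 gtrDl oppr_lt0 divr_gt0 // andbT.
    by rewrite ltr_pdivrMr // ltr_pMr // ltr1n orbT.
  case/andP => ba1 ba2; suff: a <= b0 by rewrite leNgt ba2.
  apply: ge_inf; first by exists 0.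
  split; first by rewrite ba (le_trans (ltW ba2)).
  by apply: H; rewrite ltr_norml ltrBrDl ltrBlDl; lra.
have a_lt1 : a < 1.
  rewrite lt_neqAle a1 andbT; apply/eqP => a1E; apply: nUa; rewrite a1E.
  by exists z1.
have [|eta eta0 H] := nU_open a _ nUa; first by rewrite a0.
have [b Sb ba] := inf_adherent eta0 S_inf.
have ab : a <= b by apply: ge_inf => //; exists 0.
by apply: (H b); [rewrite ger0_norm ?subr_ge0 // ltrBlDl|case: Sb].
Qed.

End Family.
End RootContinuity.

(** * Evaluation of homogeneous polynomials on lines *)

Section Evaluation.

Lemma rmorph_mmap (d : nat) (K : nzRingType) (S T : comNzRingType)
    (phi : {rmorphism S -> T}) (h : K -> S) (h' : K -> T) (l : 'I_d -> S)
    (l' : 'I_d -> T) (p : {mpoly K[d]}) :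
    (forall a, phi (h a) = h' a) -> (forall i, phi (l i) = l' i) ->
  phi (mmap h l p) = mmap h' l' p.
Proof.
move=> hE lE; rewrite /mmap raddf_sum /=; apply: eq_bigr => m _.
rewrite rmorphM hE; congr (_ * _); rewrite /mmap1 rmorph_prod.
by apply: eq_bigr => i _; rewrite rmorphXn /= lE.
Qed.

Lemma mmap_dhomog_scale (d n : nat) (K : nzRingType) (S : comNzRingType)
    (h : K -> S) (l : 'I_d -> S) (c : S) (p : {mpoly K[d]}) :
  p \is n.-homog -> mmap h (fun i => c * l i) p = c ^+ n * mmap h l p.
Proof.
move=> /dhomogP hp; rewrite /mmap mulr_sumr; apply: eq_big_seq => m mp.
have mn : mdeg m = n by exact: hp.
rewrite mulrCA; congr (_ * _); rewrite -mn mdegE -prodrXr -big_split /=.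
by apply: eq_bigr => i _; rewrite exprMn.
Qed.

(** The line t |-> t a + b at infinity: the coefficient of degree [n] of the
    restriction is the value of [p] at the direction [a], which bounds the degree
    and makes the leading coefficient independent of [b]. *)
Lemma mmap_dhomog_line (d n : nat) (K : nzRingType) (S : comNzRingType)
    (h : K -> S) (a b : 'I_d -> S) (p : {mpoly K[d]}) :
    p \is n.-homog ->
  let f := mmap (fun r => (h r)%:P) (fun i => a i *: 'X + (b i)%:P) p in
  (size f <= n.+1)%N /\ f`_n = mmap h a p.
Proof.
pose P k (q : {poly S}) (c : S) := (size q <= k.+1)%N /\ q`_k = c.
have PM k1 q1 c1 k2 q2 c2 :
    P k1 q1 c1 -> P k2 q2 c2 -> P (k1 + k2)%N (q1 * q2) (c1 * c2).
  case=> s1 <- [s2 <-]; split.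
    rewrite (leq_trans (size_polyMleq _ _)) // -subn1 leq_subLR add1n -addSn -addnS.
    exact: leq_add.
  have lt1 : (k1 < (k1 + k2).+1)%N by rewrite ltnS leq_addr.
  rewrite coefM (bigD1 (Ordinal lt1)) //= addKn big1 ?addr0 // => i ik.
  have [ki|ki|ki] := ltngtP i k1; last by case/eqP: ik; apply: val_inj.
    rewrite [q2`_ _]nth_default ?mulr0 // (leq_trans s2) //.
    by rewrite ltn_subRL -(ltn_add2r k2) in ki *; rewrite addnC -addnC ki.
  by rewrite [q1`_ _]nth_default ?mul0r // (leq_trans s1).
have PX k q c j : P k q c -> P (k * j)%N (q ^+ j) (c ^+ j).
  move=> H; elim: j => [|j IH].
    by rewrite muln0 !expr0; split; rewrite ?size_poly1 // coef1.
  by rewrite mulnS !exprS; apply: (PM).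
have P1 i : P 1%N (a i *: 'X + (b i)%:P) (a i).
  split; last by rewrite coefD coefZ coefX coefC mulr1 addr0.
  rewrite (leq_trans (size_polyD _ _)) // geq_max.
  rewrite (leq_trans (size_scale_leq _ _)) ?size_polyX //.
  by rewrite (leq_trans (size_polyC_leq1 _)).
move=> /dhomogP hp /=.
suff H m : m \in msupp p ->
    P n ((h p@_m)%:P * mmap1 (fun i => a i *: 'X + (b i)%:P) m)
        (h p@_m * mmap1 a m).
  split.
    rewrite /mmap big_seq; apply: (big_ind (fun q : {poly S} => size q <= n.+1)%N).
    - by rewrite size_poly0.
    - move=> q1 q2 s1 s2; rewrite (leq_trans (size_polyD _ _)) // geq_max s1 //.
    - by move=> m /H[].
  by rewrite /mmap coef_sum; apply: eq_big_seq => m /H[].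
move=> /hp /= mn; rewrite -mn -[X in P X _ _]add0n; apply: (PM).
  by split; rewrite ?coefC // size_polyC_leq1.
rewrite mdegE /mmap1; apply: (big_rec3 (fun k q c => P k q c)) => [|i k q c _ IH].
  by split; rewrite ?size_poly1 // coef1.
by apply: (PM) => //; rewrite -[X in P X _ _]mul1n; apply: (PX).
Qed.

End Evaluation.

(** * Real-rooted univariate polynomials and orders of vanishing *)

Section RealRooted.
Context {R : realType}.
Implicit Types (f g : {poly R}) (t : R).

Lemma poly_ge0_at0 f : (forall t, 0 < t -> 0 <= f.[t]) -> 0 <= f.[0].
Proof.
move=> f_ge0; rewrite leNgt; apply/negP => f0.
have [|d d0 H] := @poly_cont _ 0 f (- f.[0]); first by rewrite oppr_gt0.
have d2 : 0 < d / 2 by rewrite divr_gt0.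
have := H (d / 2); rewrite subr0 gtr0_norm // ltr_pdivrMr // ltr_pMr // ltr1n.
move=> /(_ isT); rewrite ltr_norml => /andP[_].
by rewrite ltrBlDr addNr ltNge f_ge0.
Qed.

Lemma real_rooted_split f : only_real_zeros f ->
  exists s : seq R, f = lead_coef f *: \prod_(a <- s) ('X + a%:P).
Proof.
move=> hf; have [rs fE] := closed_field_poly_normal (map_poly (real_complex R) f).
have [->|f0] := eqVneq f 0; first by exists [::]; rewrite lead_coef0 scale0r.
have lf0 : lead_coef f != 0 by rewrite lead_coef_eq0.
exists [seq - complex.Re z | z <- rs].
have: forall z, z \in rs -> z \is Num.real.
  move=> z zrs; apply: hf; rewrite fE rootZ ?root_prod_XsubC //.
  by rewrite lead_coef_map fmorph_eq0.
move=> rsP; apply: (map_poly_inj (real_complex R)).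
rewrite map_polyZ [LHS]fE lead_coef_map rmorph_prod /= big_map.
congr (_ *: _); apply: eq_big_seq => z /rsP zr.
rewrite rmorphD /= map_polyX map_polyC /= rmorphN polyCN.
by rewrite -{1}(RRe_real zr).
Qed.

Lemma coef_prod_XaddC_ge0 (s : seq R) j :
  (forall a, a \in s -> 0 <= a) -> 0 <= (\prod_(a <- s) ('X + a%:P))`_j.
Proof.
elim: s j => [|a s IH] j sP; first by rewrite big_nil coef1 ler0n.
have {}IH i : 0 <= (\prod_(b <- s) ('X + b%:P))`_i.
  by apply: IH => b bs; rewrite sP // inE bs orbT.
rewrite big_cons mulrDl coefD coefXM coefCM addr_ge0 //; first by case: ifP.
by rewrite mulr_ge0 // sP ?mem_head.
Qed.

Lemma root_prod_XaddC (s : seq R) t :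
  root (\prod_(a <- s) ('X + a%:P)) t = (- t \in s).
Proof.
elim: s => [|a s IH]; first by rewrite big_nil (negPf (root1 _)).
by rewrite big_cons rootM IH inE /root !hornerE addrC addr_eq0 eq_sym eqr_oppLR.
Qed.

Lemma real_rooted_coef_ge0 f : only_real_zeros f -> 0 < lead_coef f ->
  (forall t, 0 < t -> ~~ root f t) -> forall j, 0 <= f`_j.
Proof.
move=> /real_rooted_split[s fE] lf0 fP j; rewrite fE coefZ mulr_ge0 ?(ltW lf0) //.
apply: coef_prod_XaddC_ge0 => a as_; rewrite leNgt; apply/negP => a0.
move: (fP (- a)); rewrite oppr_gt0 => /(_ a0).
by rewrite fE rootZ ?gt_eqF // root_prod_XaddC opprK as_.
Qed.

Lemma horner_ge0 f t : (forall j, 0 <= f`_j) -> 0 <= t -> 0 <= f.[t].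
Proof.
move=> f0 t0; rewrite horner_coef; apply: sumr_ge0 => i _.
by rewrite mulr_ge0 // exprn_ge0.
Qed.

Lemma horner_homo f s t : (forall j, 0 <= f`_j) -> 0 <= s <= t -> f.[s] <= f.[t].
Proof.
move=> f0 /andP[s0 st]; rewrite !horner_coef; apply: ler_sum => i _.
by rewrite ler_wpM2l // lerXn2r // nnegrE // (le_trans s0).
Qed.

(** Induct on the order: once [g] and [f] are divided by the power of 'X already
    found in [g], the quotient of [f] vanishes at 0, and the inequalities pass to
    the limit there. *)
Lemma dvdXn_squeeze f g m : (forall t, 0 < t -> 0 <= g.[t] <= f.[t]) ->
  'X^m %| f -> 'X^m %| g.
Proof.
move=> gf /dvdpP[h fE]; elim: m h fE => [|m IH] h fE; first by rewrite dvd1p.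
have /dvdpP[k gE] : 'X^m %| g.
  by apply: (IH (h * 'X)); rewrite -mulrA -exprS.
suff /factor_theorem[k' kE] : root k 0.
  by apply/dvdpP; exists k'; rewrite gE kE polyC0 subr0 exprS mulrA.
have khP t : 0 < t -> 0 <= k.[t] <= (h * 'X).[t].
  move=> t0; have := gf t t0; rewrite gE fE !hornerE.
  rewrite exprS mulrA (pmulr_lge0 _ (exprn_gt0 m t0)).
  by rewrite (ler_pM2r (exprn_gt0 m t0)).
have k0 : 0 <= k.[0] by apply: poly_ge0_at0 => t /khP/andP[].
have : 0 <= (h * 'X - k).[0].
  by apply: poly_ge0_at0 => t /khP/andP[_]; rewrite hornerD hornerN subr_ge0.
rewrite !hornerE ?mulr0 ?sub0r oppr_ge0 => k0'.
by rewrite /root eq_le k0 k0'.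
Qed.

Lemma dvdXn_comp_scale (f : {poly R}) m a : 'X^m %| f -> 'X^m %| f \Po (a *: 'X).
Proof.
move=> /dvdpP[h ->]; rewrite comp_polyM comp_Xn_poly exprZn -scalerAr scalerAl.
exact: dvdp_mull.
Qed.

Lemma poly_ext (f g : {poly R}) : (forall t, f.[t] = g.[t]) -> f = g.
Proof.
move=> fg; apply/eqP; rewrite -subr_eq0; apply/negPn/negP => fg0.
have := @cauchy_boundP _ _ (cauchy_bound (f - g)) fg0.
rewrite hornerD hornerN fg subrr => /(_ erefl).
by rewrite ger0_norm ?ltxx // cauchy_bound_ge0.
Qed.

(** With nonnegative coefficients, a polynomial decreases to the left of 0 at most
    at the average rate of its growth on [[0, 1]]. *)
Lemma horner_neg_ge (f : {poly R}) (s : R) : (forall j, 0 <= f`_j) -> 0 <= s <= 1 ->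
  f.[0] - s * (f.[1] - f.[0]) <= f.[- s].
Proof.
elim/poly_ind: f => [|g c _] f0 /andP[s0 s1]; first by rewrite !hornerE; lra.
have g0 j : 0 <= g`_j.
  by have := f0 j.+1; rewrite coefD coefMX coefC /= addr0.
rewrite !hornerE.
have : g.[- s] <= g.[1].
  rewrite !horner_coef; apply: ler_sum => i _; rewrite ler_wpM2l // expr1n.
  by rewrite (le_trans (ler_norm _)) // normrX normrN ger0_norm // exprn_ile1.
by move=> /(ler_wpM2l s0) gs; lra.
Qed.

End RealRooted.

(** * Convexity of the hyperbolicity cone and positivity on it *)

Section Garding.
Context {R : realType} {V : vectType R}.
Local Notation C := R[i].
Local Notation Im := (@complex.Im R).
Local Notation Re := (@complex.Re R).
Local Notation "x %:C" := (real_complex R x).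
Local Notation d := (\dim {:V}).
Implicit Types (p q : {mpoly R[d]}) (e u v x y z : V) (t : R).

(** [p] at a point of the complexification of [V], given by coordinates. *)
Definition cval p (l : 'I_d -> C) : C := mmap (real_complex R) l p.

Definition ccoord v : 'I_d -> C := fun i => (vcoord v i)%:C.

Lemma cval_ccoord p v : cval p (ccoord v) = (pval p v)%:C.
Proof.
by symmetry; apply: (rmorph_mmap (phi := real_complex R) (h := idfun)).
Qed.

Lemma horner_pline_complex p u v w :
  (map_poly (real_complex R) (pline p u v)).[w] =
  cval p (fun i => w * ccoord u i + ccoord v i).
Proof.
apply: (rmorph_mmap (phi := horner_eval w \o map_poly (real_complex R))) => [a|i] /=.
  by rewrite map_polyC horner_evalE hornerC.
rewrite rmorphD /= map_polyZ map_polyX map_polyC horner_evalE !hornerE.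
by rewrite mulrC.
Qed.

Lemma ccoordP a u v i : ccoord (a *: u + v) i = a%:C * ccoord u i + ccoord v i.
Proof. by rewrite /ccoord /vcoord linearP rmorphD rmorphM. Qed.

Lemma pvalZ n p a v : p \is n.-homog -> pval p (a *: v) = a ^+ n * pval p v.
Proof.
move=> hp; rewrite /pval /meval -mmap_dhomog_scale //; congr mmap.
by apply/funext => i; rewrite /vcoord linearZ.
Qed.

Lemma size_pline n p u v : p \is n.-homog -> (size (pline p u v) <= n.+1)%N.
Proof. by move=> /(mmap_dhomog_line idfun (vcoord u) (vcoord v)) []. Qed.

Lemma coef_pline n p u v : p \is n.-homog -> (pline p u v)`_n = pval p u.
Proof. by move=> /(mmap_dhomog_line idfun (vcoord u) (vcoord v)) []. Qed.

Lemma lead_coef_pline n p u v : p \is n.-homog -> pval p u != 0 ->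
  size (pline p u v) = n.+1 /\ lead_coef (pline p u v) = pval p u.
Proof.
move=> hp pu; have sz : size (pline p u v) = n.+1.
  apply/eqP; rewrite eqn_leq (size_pline _ _ hp) ltnNge; apply: contra pu => sz.
  by rewrite -(coef_pline u v hp) nth_default.
by split; rewrite // lead_coefE sz /= (coef_pline _ _ hp).
Qed.

(** [root_half_plane_homotopy] along the segment from [a] to [b]; the leading
    coefficient of w |-> p (w y + x) is [p y] throughout. *)
Lemma cval_homotopy n p (a b y : 'I_d -> C) : p \is n.-homog -> cval p y != 0 ->
  (forall s t : R, 0 <= s < 1 ->
     cval p (fun i => t%:C * y i + ((1 - s)%:C * a i + s%:C * b i)) != 0) ->
  (forall w, 0 < Im w -> cval p (fun i => w * y i + a i) != 0) ->
  forall w, 0 < Im w -> cval p (fun i => w * y i + b i) != 0.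
Proof.
move=> hp py Hreal H0 w w0.
pose h r := (r%:C)%:P : {poly C}.
pose B i := (a i)%:P + (b i - a i) *: 'X : {poly C}.
pose F : {poly {poly C}} :=
  mmap (fun r => (h r)%:P) (fun i => (y i)%:P *: 'X + (B i)%:P) p.
have FE s r : (fibre F s).[r] =
    cval p (fun i => r * y i + ((1 - s) * a i + s * b i)).
  rewrite horner_fibre -horner_evalE -[F.[_]]horner_evalE.
  apply: (rmorph_mmap (phi := horner_eval s \o horner_eval r%:P)) => [c|i] /=.
    by rewrite !horner_evalE !hornerC.
  rewrite !horner_evalE !hornerE /=; ring.
have [szF cF] := mmap_dhomog_line h (fun i => (y i)%:P) B hp.
have {}cF : F`_n = (cval p y)%:P.
  by rewrite cF; symmetry; apply: (rmorph_mmap (phi := @polyC C)).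
have E1 : cval p (fun i => w * y i + b i) = (fibre F 1).[w].
  rewrite FE; congr mmap; apply/funext => i; ring.
rewrite E1; apply: (root_half_plane_homotopy py szF cF) => // [s t s01|z z0].
  by rewrite /root FE -[1]/(1%:C) -rmorphB Hreal.
have -> : root (fibre F 0) z = (cval p (fun i => z * y i + a i) == 0).
  rewrite /root FE; congr (mmap _ _ _ == 0); apply/funext => i; ring.
exact: H0.
Qed.

Section Cone.
Variables (n : nat) (p : {mpoly R[d]}) (e : V).

(** The hyperbolicity cone without reference to eigenvalues (see [hyp_coneE]). *)
Definition nonvanishing_cone : set V :=
  [set x | forall t, 0 < t -> pval p (t *: e + x) != 0].

Hypothesis hp : hyperbolic n p e.
Local Notation K := nonvanishing_cone.

Lemma hyperbolic_homog : p \is n.-homog. Proof. by case: hp. Qed.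

Lemma only_real_zeros_pline v : only_real_zeros (pline p e v).
Proof. by case: hp => _ _ _ _ /(_ (- v)); rewrite opprK. Qed.

Lemma pencil_root_real w v : cval p (fun i => w * ccoord e i + ccoord v i) = 0 ->
  Im w = 0.
Proof.
rewrite -horner_pline_complex => /rootP /only_real_zeros_pline.
by case/complex_realP => r ->.
Qed.

(** Divide by [w]: by homogeneity a / w is an eigenvalue of [- y]. *)
Lemma cone_pencil_root y a w : K y -> w != 0 ->
  cval p (fun i => a * ccoord e i + w * ccoord y i) = 0 ->
  exists2 r : R, r <= 0 & a = r%:C * w.
Proof.
move=> Ky w0 H.
have : cval p (fun i => (a / w) * ccoord e i + ccoord y i) = 0.
  apply: (mulfI (expf_neq0 n w0)); rewrite mulr0 -mmap_dhomog_scale ?hyperbolic_homog //.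
  rewrite -[RHS]H; congr mmap; apply/funext => i.
  by rewrite mulrDr mulrA mulrCA divff ?mulr1.
rewrite -horner_pline_complex => /[dup] /rootP /only_real_zeros_pline.
case/complex_realP => r aE; rewrite aE horner_map /= horner_pline => /complexI pr.
exists r; last by rewrite -aE divfK.
by rewrite leNgt; apply/negP => /Ky; rewrite pr eqxx.
Qed.

(** Garding's theorem that [p] is hyperbolic in every direction [y] of the open
    cone.  Deform p ((1 - s) i e + s x + w y): for [s < 1] a real zero [w] would
    give [p] a nonreal zero on a line in direction [e], and at [s = 0] the zeros
    are i divided by the nonpositive zeros of t |-> p (t e + y), hence not in the
    upper half-plane. *)
Lemma cone_direction_real_rooted x y w : K y -> pval p y != 0 -> 0 < Im w ->
  cval p (fun i => w * ccoord y i + ccoord x i) != 0.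
Proof.
move=> Ky py; apply: (@cval_homotopy _ _ (fun i => 'i%C * ccoord e i)).
- exact: hyperbolic_homog.
- by rewrite cval_ccoord fmorph_eq0.
- move=> s t /andP[_ s1]; apply/eqP => H.
  have /pencil_root_real : cval p (fun i => ((1 - s)%:C * 'i%C) * ccoord e i
      + ccoord (t *: y + s *: x) i) = 0.
    rewrite -[RHS]H; congr mmap; apply/funext => i.
    rewrite ccoordP -[s *: x]addr0 ccoordP /ccoord /vcoord raddf0 rmorph0; ring.
  by rewrite /= !mul0r ?mulr1 ?mulr0 ?add0r ?addr0 => /eqP; rewrite subr_eq0 gt_eqF.
move=> w0 w0_gt0; apply/eqP => H.
have [||r r0] := @cone_pencil_root y 'i%C w0 Ky.
- by apply: contraTneq w0_gt0 => ->; rewrite ltxx.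
- by rewrite -[RHS]H; congr mmap; apply/funext => i; rewrite addrC.
case: w0 w0_gt0 {H} => a b /= b0 [_]; rewrite mul0r addr0 => rb.
by have := ltr01 (R := R); rewrite rb ltNge mulr_le0_ge0 // ltW.
Qed.

Lemma only_real_zeros_cone_direction x y : K y -> pval p y != 0 ->
  only_real_zeros (pline p y x).
Proof.
move=> Ky py w; set f := map_poly _ _ => fw.
have upper w' : root f w' -> Im w' <= 0.
  rewrite leNgt => fw'; apply/negP => w0.
  have := cone_direction_real_rooted x Ky py w0.
  by rewrite -horner_pline_complex (rootP fw') eqxx.
have fJ : map_poly (@conjc R) f = f.
  by rewrite -map_poly_comp; apply: eq_map_poly => a; apply: conjc_real.
have := upper w^*%C; rewrite -complex_root_conj fJ => /(_ fw).
have := upper w fw; case: w {fw} => a b /= b1 b2.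
by rewrite complex_real eq_le b1 -oppr_le0.
Qed.

(** Deform p ((1 - s) e + s z + w y) with [w] in the right half-plane, which the
    factor -i carries to the upper one.  A zero on the imaginary axis would have
    to be [w = 0] by real-rootedness in direction [y], but [p] does not vanish on
    the segment from [e] to [z] before its endpoint. *)
Lemma cone_half_plane y z w : K y -> pval p y != 0 -> K z -> 0 < Re w ->
  cval p (fun i => w * ccoord y i + ccoord z i) != 0.
Proof.
move=> Ky py Kz w0; pose w' := 'i%C * w.
have ii : 'i%C * - 'i%C = 1 :> C by rewrite mulrN -expr2 sqr_i opprK.
have -> : cval p (fun i => w * ccoord y i + ccoord z i) =
    cval p (fun i => w' * (- 'i%C * ccoord y i) + ccoord z i).
  congr mmap; apply/funext => i; rewrite /w' mulrA [_ * w]mulrC -[w * _ * _]mulrA.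
  by rewrite ii mulr1.
have {w0} : 0 < Im w' by rewrite /w' mulrC ImiRe.
have iN0 : - 'i%C != 0 :> C by rewrite oppr_eq0 eq_complex /= oner_eq0 andbF.
apply: (@cval_homotopy n _ (ccoord e)); first exact: hyperbolic_homog.
- rewrite /cval (mmap_dhomog_scale _ _ _ hyperbolic_homog) mulf_neq0 //.
    by rewrite expf_neq0.
  by have := cval_ccoord p y; rewrite /cval => ->; rewrite fmorph_eq0.
- move=> s t /andP[s0 s1]; apply/eqP => H.
  pose v := (1 - s) *: e + s *: z.
  have : cval p (fun i => (t%:C * - 'i%C) * ccoord y i + ccoord v i) = 0.
    rewrite -[RHS]H; congr mmap; apply/funext => i.
    rewrite ccoordP -[s *: z]addr0 ccoordP /ccoord /vcoord raddf0 rmorph0; ring.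
  rewrite -horner_pline_complex => /[dup] /rootP.
  move=> /(only_real_zeros_cone_direction Ky py) /complex_realP[r].
  have [->|t0] := eqVneq t 0; last first.
    by case=> _ /eqP + _; rewrite mul0r addr0 mulrN1 oppr_eq0 (negPf t0).
  move=> _; rewrite rmorph0 mul0r -(rmorph0 (real_complex R)) horner_map /=.
  rewrite horner_pline scale0r add0r => /complexI /eqP; apply/negP; rewrite /v.
  have [->|sN0] := eqVneq s 0.
    by rewrite subr0 scale1r scale0r addr0; case: hp.
  have -> : (1 - s) *: e + s *: z = s *: ((1 - s) / s *: e + z).
    by rewrite scalerDr scalerA mulrCA divff // mulr1.
  rewrite (pvalZ _ _ hyperbolic_homog) mulf_neq0 ?expf_neq0 // Kz //.
  by rewrite divr_gt0 ?subr_gt0 // lt0r sN0.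
move=> w0 w0_gt0; apply/eqP => H.
have [||r r0] := @cone_pencil_root y 1 (w0 * - 'i%C) Ky.
- by rewrite mulf_neq0 //; apply: contraTneq w0_gt0 => ->; rewrite ltxx.
- rewrite -[RHS]H; congr mmap; apply/funext => i; ring.
case: w0 w0_gt0 {H} => a b /= b0 [].
rewrite !(mul0r, mulr0, mulr1, mulrN, oppr0, sub0r, subr0, opprK) => rb _.
by have := ltr01 (R := R); rewrite rb ltNge mulr_le0_ge0 // ltW.
Qed.

Lemma cone_no_pos_root y z t : K y -> pval p y != 0 -> K z -> 0 < t ->
  ~~ root (pline p y z) t.
Proof.
move=> Ky py Kz t0; have := @cone_half_plane y z t%:C Ky py Kz t0.
by rewrite -horner_pline_complex horner_map fmorph_eq0.
Qed.

Lemma cone_addl t x : 0 <= t -> K x -> K (t *: e + x).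
Proof. by move=> t0 Kx s s0; rewrite addrA -scalerDl Kx // ltr_wpDr. Qed.

Lemma cone_scale a x : 0 < a -> K x -> K (a *: x).
Proof.
move=> a0 Kx t t0; have -> : t *: e + a *: x = a *: (t / a *: e + x).
  by rewrite scalerDr scalerA mulrCA divff ?mulr1 ?gt_eqF.
rewrite (pvalZ _ _ hyperbolic_homog) mulf_neq0 ?expf_neq0 ?(gt_eqF a0) //.
by rewrite Kx // divr_gt0.
Qed.

Lemma pline_neq0 x : pline p e x != 0.
Proof.
case: hp => _ _ hh pe _; have [sz _] := lead_coef_pline x hh pe.
by rewrite -size_poly_eq0 sz.
Qed.

Lemma cone0 : K 0.
Proof.
move=> t t0; rewrite addr0 (pvalZ _ _ hyperbolic_homog).
by case: hp => _ _ _ pe _; rewrite mulf_neq0 // expf_neq0 // gt_eqF.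
Qed.

(** [e] is an order unit of the cone. *)
Lemma cone_absorbs y : exists2 b : R, 0 < b & K (b *: e - y).
Proof.
exists (cauchy_bound (pline p e (- y))); first exact: cauchy_bound_gt0.
move=> t t0; rewrite addrA -scalerDl -horner_pline; apply/eqP => H.
(* the root [t + cauchy_bound] would exceed the bound *)
have := cauchy_boundP (pline_neq0 (- y)) H.
rewrite ger0_norm; first by rewrite gtrDr ltNge ltW.
by rewrite addr_ge0 ?cauchy_bound_ge0 // ltW.
Qed.

Section Positive.
Hypothesis pe : 0 < pval p e.

Lemma coef_pline_e_ge0 x j : K x -> 0 <= (pline p e x)`_j.
Proof.
move=> Kx; apply: real_rooted_coef_ge0.
- exact: only_real_zeros_pline.
- by have [_ ->] := lead_coef_pline x hyperbolic_homog (lt0r_neq0 pe).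
- by move=> t t0; rewrite /root horner_pline Kx.
Qed.

Lemma pval_cone_ge0 x : K x -> 0 <= pval p x.
Proof.
move=> Kx; have := horner_ge0 (t := 0) (fun j => coef_pline_e_ge0 j Kx) (lexx _).
by rewrite horner_pline scale0r add0r.
Qed.

Lemma pval_cone_gt0 t x : 0 < t -> K x -> 0 < pval p (t *: e + x).
Proof.
move=> t0 Kx; rewrite lt0r Kx //=.
exact: pval_cone_ge0 (cone_addl (ltW t0) Kx).
Qed.

(** For [y] replaced by [y + t e] with [t > 0] the roots are real and
    nonpositive; the coefficients are polynomial in [t], so let [t] tend to 0. *)
Lemma coef_pline_ge0 y z j : K y -> K z -> 0 <= (pline p y z)`_j.
Proof.
move=> Ky Kz.
pose G : {poly {poly R}} := mmap (fun r => (r%:P)%:P)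
  (fun i => ((vcoord y i)%:P + vcoord e i *: 'X) *: 'X + ((vcoord z i)%:P)%:P) p.
have GE s : map_poly (horner_eval s) G = pline p (s *: e + y) z.
  apply: (rmorph_mmap (phi := map_poly (horner_eval s))) => [r|i] /=.
    by rewrite map_polyC /= horner_evalE hornerC.
  rewrite rmorphD /= map_polyZ map_polyX map_polyC /= !horner_evalE !hornerE.
  by rewrite /vcoord linearP /= addrC [s * _]mulrC.
have cE s : (pline p (s *: e + y) z)`_j = (G`_j).[s].
  by rewrite -GE coef_map.
have -> : (pline p y z)`_j = (G`_j).[0] by rewrite -cE scale0r add0r.
apply: poly_ge0_at0 => t t0; rewrite -cE.
have Ky' : K (t *: e + y) by apply: cone_addl => //; apply: ltW.
have py' := pval_cone_gt0 t0 Ky.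
apply: real_rooted_coef_ge0.
- exact: only_real_zeros_cone_direction (lt0r_neq0 py').
- by have [_ ->] := lead_coef_pline z hyperbolic_homog (lt0r_neq0 py').
- by move=> s s0; apply: cone_no_pos_root => //; rewrite gt_eqF.
Qed.

Lemma pval_cone_mono y z : K y -> K z -> pval p z <= pval p (z + y).
Proof.
move=> Ky Kz; have := @horner_homo _ (pline p y z) 0 1 (fun j => coef_pline_ge0 j Ky Kz).
by rewrite !horner_pline scale0r add0r scale1r addrC lexx ler01 => ->.
Qed.

Lemma cone_add x y : K x -> K y -> K (x + y).
Proof.
move=> Kx Ky t t0; rewrite addrA gt_eqF // (lt_le_trans (pval_cone_gt0 t0 Kx)) //.
by apply: pval_cone_mono => //; apply: cone_addl => //; apply: ltW.
Qed.

End Positive.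

End Cone.
End Garding.

(** * The multiplicity of the zero eigenvalue *)

Section Multiplicity.
Context {R : realType} {V : vectType R}.
Local Notation d := (\dim {:V}).
Implicit Types (p q : {mpoly R[d]}) (e u v x y z : V) (a s t : R).

(** The corank of [x]: the multiplicity of 0 in its eigenvalue vector. *)
Definition mult p e x : nat := \mu_0 (pline p e x).

Lemma mult_le n p e x m : hyperbolic n p e ->
  (m <= mult p e x)%N = ('X^m %| pline p e x).
Proof.
by move=> hp; rewrite -(root_le_mu _ _ (pline_neq0 hp x)) polyC0 subr0.
Qed.

Lemma plineZ a p u v : pline (a *: p) u v = a *: pline p u v.
Proof. by rewrite /pline mmapZ mul_polyC. Qed.

Lemma pvalZl a p v : pval (a *: p) v = a * pval p v.
Proof. by rewrite /pval mevalZ. Qed.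

Lemma hyperbolic_scale n p e a : a != 0 -> hyperbolic n p e ->
  hyperbolic n (a *: p) e.
Proof.
move=> a0 [e0 n0 hh pe rz]; split=> //; first exact: rpredZ.
  by rewrite pvalZl mulf_neq0.
move=> x w; rewrite plineZ map_polyZ rootZ ?fmorph_eq0 //; exact: rz.
Qed.

Lemma cone_scalep p e a : a != 0 ->
  nonvanishing_cone (a *: p) e = nonvanishing_cone p e.
Proof.
move=> a0; apply/seteqP; split=> x Kx t /Kx; rewrite pvalZl mulf_eq0 (negPf a0) //.
Qed.

Lemma mult_scalep p e a x : a != 0 -> mult (a *: p) e x = mult p e x.
Proof. by move=> a0; rewrite /mult plineZ mu_mulC. Qed.

(** Scaling changes neither the cone nor multiplicities, so [p e] may be taken
    positive. *)
Lemma hyperbolic_normalize n p e : hyperbolic n p e ->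
  let q := pval p e *: p in
  [/\ hyperbolic n q e, 0 < pval q e,
      nonvanishing_cone q e = nonvanishing_cone p e
    & mult q e =1 mult p e].
Proof.
move=> hp; have pe : pval p e != 0 by case: hp.
split; [exact: hyperbolic_scale| |exact: cone_scalep|move=> x; exact: mult_scalep].
by rewrite pvalZl -expr2 exprn_even_gt0.
Qed.

Lemma cone_addW n p e x y : hyperbolic n p e ->
  nonvanishing_cone p e x -> nonvanishing_cone p e y ->
  nonvanishing_cone p e (x + y).
Proof.
move=> /hyperbolic_normalize[hq qe <- _]; exact: cone_add hq qe _ _.
Qed.

(** For [t > 0], p (t e + x) is at most p (t e + x + y), so it vanishes at 0 at
    least to the same order. *)
Lemma mult_mono n p e x y : hyperbolic n p e ->
  nonvanishing_cone p e x -> nonvanishing_cone p e y ->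
  (mult p e (x + y) <= mult p e x)%N.
Proof.
move=> /hyperbolic_normalize; set q := _ *: p => -[hq qe <- mE] Kx Ky.
rewrite -!mE (mult_le _ _ hq).
apply: (@dvdXn_squeeze _ (pline q e (x + y))); last by rewrite -(mult_le _ _ hq).
move=> t t0; rewrite !horner_pline addrA (ltW (pval_cone_gt0 hq qe t0 Kx)) /=.
by apply: (pval_cone_mono hq qe) => //; apply: cone_addl (ltW t0) _.
Qed.

Lemma mult_scale n p e x a : hyperbolic n p e -> 0 < a ->
  nonvanishing_cone p e x -> (mult p e x <= mult p e (a *: x))%N.
Proof.
move=> hp a0 Kx; rewrite (mult_le _ _ hp).
have -> : pline p e (a *: x) = a ^+ n *: (pline p e x \Po (a^-1 *: 'X)).
  apply: poly_ext => t.
  rewrite hornerZ horner_comp !horner_pline -(pvalZ _ _ (hyperbolic_homog hp)).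
  rewrite scalerDr !hornerE scalerA mulrA mulrV ?mul1r //.
  by rewrite unitfE gt_eqF.
rewrite dvdpZr ?expf_neq0 ?gt_eqF //; apply: dvdXn_comp_scale.
by rewrite -(mult_le _ _ hp).
Qed.

(** Equal orders of vanishing make the ratio of p (t e + x + y) to p (t e + x)
    bounded on 0 < t <= 1.  By [horner_neg_ge] in the direction [y], this keeps
    p (t e + x - s y) positive there for one small [s], uniformly in [t].  For
    t > 1 the term t e absorbs s y. *)
Lemma same_mult_interior n p e x y : hyperbolic n p e ->
  nonvanishing_cone p e x -> nonvanishing_cone p e y ->
  mult p e (x + y) = mult p e x ->
  exists2 s : R, 0 < s & nonvanishing_cone p e (x - s *: y).
Proof.
move=> /hyperbolic_normalize; set q := _ *: p => -[hq qe <- mE] Kx Ky.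
rewrite -!mE => mxy; set m := mult q e x in mxy.
have Kxy := cone_add hq qe Kx Ky.
have fact z : nonvanishing_cone q e z -> mult q e z = m -> exists2 g : {poly R},
    pline q e z = g * 'X^m & (forall j, 0 <= g`_j) /\ 0 < g.[0].
  move=> Kz mz; have /dvdpP[g gE] : 'X^m %| pline q e z by rewrite -(mult_le _ _ hq) mz.
  exists g => //; have g0 j : 0 <= g`_j.
    by have := coef_pline_e_ge0 hq qe (j + m) Kz; rewrite gE coefMXn ltnNge leq_addl addnK.
  split=> //; rewrite lt0r horner_ge0 // andbT; apply/negP => /factor_theorem[h hE].
  have : (m.+1 <= mult q e z)%N.
    by rewrite (mult_le _ _ hq) gE hE polyC0 subr0 -mulrA -exprS dvdp_mull.
  by rewrite mz ltnn.
have [a aE [a_ge0 a0]] := fact x Kx (erefl _).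
have [b bE [b_ge0 b0]] := fact (x + y) Kxy mxy.
have [D D0 KD] := cone_absorbs hq y.
have [c c0 b1] : exists2 c : R, 0 <= c & b.[1] = c * a.[0].
  exists (b.[1] / a.[0]); last by rewrite divfK // gt_eqF.
  by rewrite divr_ge0 ?(ltW a0) // horner_ge0.
(* [s] is positive with s c < 1, for t <= 1, and s D < 1, for t > 1 *)
have [s s0 sN] : exists2 s : R, 0 < s & s + s * c + s * D = 1.
  have N0 : 0 < 1 + c + D by rewrite addr_gt0 // ltr_wpDr.
  exists (1 + c + D)^-1; first by rewrite invr_gt0.
  by rewrite -[RHS](mulVf (lt0r_neq0 N0)); ring.
have sc0 : 0 <= s * c by rewrite mulr_ge0 // ltW.
have sD0 : 0 < s * D by rewrite mulr_gt0.
have sc1 : s * c <= 1 by lra.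
have s01 : 0 <= s <= 1 by apply/andP; split; lra.
exists s => // t t0; have [t1|t1] := leP t 1; last first.
  (* s (D e - y) is in the cone, and 1 - s D >= 0 *)
  have -> : t *: e + (x - s *: y) =
      (t - 1) *: e + (x + ((1 - s * D) *: e + s *: (D *: e - y))).
    rewrite scalerBr scalerA !scalerBl scale1r [_ - _ + (_ - _)]addrA subrK.
    by rewrite [x + (e + _)]addrCA [RHS]addrA subrK.
  apply: (cone_add hq qe Kx); last by rewrite subr_gt0.
  by apply: cone_addl; [lra|apply: (cone_scale hq)].
pose f := pline q y (t *: e + x).
have f_ge0 j : 0 <= f`_j.
  by apply: (coef_pline_ge0 hq qe) => //; apply: cone_addl (ltW t0) _.
have f0E : f.[0] = a.[t] * t ^+ m.
  by rewrite horner_pline scale0r add0r -horner_pline aE !hornerE.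
have f1E : f.[1] = b.[t] * t ^+ m.
  by rewrite horner_pline scale1r [y + _]addrC -addrA -horner_pline bE !hornerE.
rewrite addrA addrC -scaleNr -horner_pline -/f gt_eqF //.
apply: lt_le_trans _ (horner_neg_ge f_ge0 s01).
rewrite f0E f1E -mulrBl mulrA -mulrBl.
apply: mulr_gt0; last exact: exprn_gt0.
have at0 : a.[0] <= a.[t] by apply: horner_homo => //; rewrite lexx ltW.
have bt1 : b.[t] <= b.[1] by apply: horner_homo => //; rewrite ltW.
have at_gt0 : 0 < a.[t] by apply: lt_le_trans at0.
have bt : b.[t] <= c * a.[t].
  by apply: (le_trans bt1); rewrite b1; exact: (ler_wpM2l c0 at0).
have := ler_wpM2l (ltW s0) bt; rewrite mulrA => sb.
have := ler_wpM2r (ltW at_gt0) sc1; rewrite mul1r => sca.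
rewrite subr_gt0 mulrBr ltrBlDr; apply: (le_lt_trans (le_trans sb sca)).
by rewrite ltrDl mulr_gt0.
Qed.

End Multiplicity.

(** * Rank-one steps and the lower bound on the degree *)

Section RankOne.
Context {R : realType} {V : vectType R}.
Local Notation d := (\dim {:V}).
Implicit Types (p q : {mpoly R[d]}) (e u v x y z : V) (a s t : R).

(** In a rank-one direction [c] the polynomial [p] is affine: p (s z + c) is
    squeezed below p (s b e + c), which vanishes to order n - 1 at [s = 0], and by
    homogeneity this bounds the degree of w |-> p (z + w c) by 1.  With
    A t = p (t e + x) and B t = p (t e + x + c), moving from t e + x by t c gives
    A + t (B - A), squeezed below A ((1 + b) t); so t (B - A) vanishes at least
    to the order of A, and B to at least one order less. *)
Lemma mult_rank_one_step n p e x c : hyperbolic n p e ->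
  nonvanishing_cone p e x -> nonvanishing_cone p e c ->
  (n.-1 <= mult p e c)%N -> (mult p e x <= (mult p e (x + c)).+1)%N.
Proof.
move=> /hyperbolic_normalize; set q := _ *: p => -[hq qe <- mE] Kx Kc.
rewrite -!mE (mult_le _ _ hq) => Xc.
(* [h] below is the affine polynomial with p (s z + c) = s ^ (n - 1) h(s) *)
have affine z t : nonvanishing_cone q e z -> 0 < t ->
    pval q (t *: c + z) = pval q z + t * (pval q (z + c) - pval q z).
  move=> Kz t0; have [b b0 Kb] := cone_absorbs hq z.
  have /dvdpP[h hE] : 'X^(n.-1) %| pline q z c.
    apply: dvdXn_squeeze (dvdXn_comp_scale b Xc) => s s0.
    rewrite horner_comp !hornerE !horner_pline.
    have Ksz := cone_scale hq s0 Kz.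
    rewrite (pval_cone_ge0 hq qe) /=; last exact: (cone_add hq qe Ksz Kc).
    have -> : (b * s) *: e + c = (s *: z + c) + s *: (b *: e - z).
      by rewrite scalerBr scalerA addrAC [_ + (_ - _)]addrC subrK [s * b]mulrC.
    apply: (pval_cone_mono hq qe); first exact: (cone_scale hq s0 Kb).
    exact: (cone_add hq qe Ksz Kc).
  have n0 : (0 < n)%N by case: hq.
  have szh : (size h <= 2)%N.
    have [->|h0] := eqVneq h 0; first by rewrite size_poly0.
    have := size_pline z c (hyperbolic_homog hq).
    by rewrite hE size_Mmonic ?monicXn // size_polyXn addnS /= -{2}(prednK n0)
      -[n.-1.+2]add2n leq_add2r.
  have hE2 s : h.[s] = h`_0 + h`_1 * s.
    by rewrite (horner_coef_wide s szh) !big_ord_recl big_ord0 /= expr0 expr1 mulr1 addr0.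
  have zE : pval q z = h`_1.
    rewrite -(coef_pline z c (hyperbolic_homog hq)) hE coefMXn.
    by rewrite -{1 2}(prednK n0) ltnNge leqnSn /= -{1}(prednK n0) subSnn.
  have valE s : 0 < s -> pval q (s *: c + z) = h`_0 * s + h`_1.
    move=> s0; have -> : s *: c + z = s *: (s^-1 *: z + c).
      by rewrite scalerDr scalerA divff ?gt_eqF // scale1r addrC.
    have sn : s ^+ n * s^-1 ^+ n.-1 = s.
      by rewrite -{1}(prednK n0) exprS -mulrA -exprMn divff ?gt_eqF // expr1n mulr1.
    rewrite (pvalZ _ _ (hyperbolic_homog hq)) -horner_pline hE hornerM hornerXn.
    by rewrite mulrCA sn hE2 mulrDl mulfVK ?gt_eqF.
  have := valE 1 ltr01; rewrite scale1r addrC => ->.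
  by rewrite (valE t t0) zE; ring.
case mx : (mult q e x) => [//|m]; rewrite ltnS (mult_le _ _ hq).
have [b b0 Kb] := cone_absorbs hq c.
set A := pline q e x; set B := pline q e (x + c).
have XA : 'X^(m.+1) %| A by rewrite -(mult_le _ _ hq) mx.
have : 'X^(m.+1) %| A + 'X * (B - A).
  apply: dvdXn_squeeze (dvdXn_comp_scale (1 + b) XA) => t t0.
  have Kz := cone_addl (ltW t0) Kx.
  have Ktc := cone_scale hq t0 Kc.
  have -> : (A + 'X * (B - A)).[t] = pval q (t *: c + (t *: e + x)).
    by rewrite affine // !hornerE !horner_pline addrA.
  rewrite (pval_cone_ge0 hq qe) /=; last exact: (cone_add hq qe Ktc Kz).
  rewrite horner_comp hornerZ hornerX horner_pline.
  have -> : ((1 + b) * t) *: e + x = t *: c + (t *: e + x) + t *: (b *: e - c).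
    rewrite scalerBr addrAC [_ + (_ - _)]addrC subrK addrA scalerA -scalerDl.
    by congr (_ *: _ + _); ring.
  apply: (pval_cone_mono hq qe); first exact: (cone_scale hq t0 Kb).
  exact: (cone_add hq qe Ktc Kz).
rewrite dvdp_addr // exprS dvdp_mul2l ?polyX_eq0 // dvdp_subl //.
by apply: dvdp_trans XA; rewrite exprS dvdp_mull.
Qed.

Lemma mult0 n p e : hyperbolic n p e -> mult p e 0 = n.
Proof.
move=> hp; have pe : pval p e != 0 by case: hp.
rewrite /mult; have -> : pline p e 0 = pval p e *: 'X^n.
  apply: poly_ext => t.
  by rewrite horner_pline addr0 (pvalZ _ _ (hyperbolic_homog hp)) !hornerE mulrC.
by rewrite mu_mulC // -['X]subr0 -polyC0 mu_exp mu_XsubC mul1n.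
Qed.

Lemma mult_eq0 p e x : pval p x != 0 -> mult p e x = 0%N.
Proof. by move=> px; apply: muNroot; rewrite /root horner_pline scale0r add0r. Qed.

(** The set [S] is separate from the cone of [p] because the bound for the
    derivative polynomial follows partial sums that stay in the smaller cone of
    the original polynomial. *)
Lemma degree_le_of_chain n p m q e (S : set V) (cs : seq V) :
    hyperbolic n p e -> hyperbolic m q e ->
    nonvanishing_cone q e = nonvanishing_cone p e ->
    S `<=` nonvanishing_cone p e -> S 0 ->
    (forall x c, S x -> c \in cs ->
       [/\ S c, S (x + c) & (mult p e x <= (mult p e (x + c)).+1)%N]) ->
    mult p e (\sum_(c <- cs) c) = 0%N ->
  (n <= m)%N.
Proof.
move=> hp hq Kqp SK S0 step sum0.
have Kq x : S x -> nonvanishing_cone q e x by rewrite Kqp; apply: SK.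
have step1 x c : S x -> c \in cs ->
    (mult p e x + mult q e (x + c) <= mult q e x + mult p e (x + c))%N.
  move=> Sx cc; have [Sc Sxc mp] := step x c Sx cc.
  have := mult_mono hq (Kq _ Sx) (Kq _ Sc).
  rewrite leq_eqVlt => /predU1P[mq|mq]; last first.
    by rewrite (leq_trans (leq_add mp (leqnn _))) // addSn -addnS addnC leq_add2r.
  rewrite mq [leqRHS]addnC leq_add2r.
  have [s s0 Ks] := same_mult_interior hq (Kq _ Sx) (Kq _ Sc) mq.
  rewrite Kqp in Ks.
  have s10 : 0 < 1 + s^-1 by rewrite addr_gt0 ?invr_gt0.
  apply: leq_trans (mult_scale hp s10 (SK _ Sx)) _.
  (* [x] is, up to a factor, above [x + c] in the order of the cone *)
  have -> : (1 + s^-1) *: x = (x + c) + s^-1 *: (x - s *: c).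
    rewrite scalerDl scale1r scalerBr scalerA mulVf ?gt_eqF // scale1r.
    by rewrite addrAC -addrA subrK addrC.
  apply: mult_mono hp (SK _ Sxc) (cone_scale hp _ Ks).
  by rewrite invr_gt0.
have chain x : S x -> (mult p e x + mult q e (x + \sum_(c <- cs) c) <=
    mult q e x + mult p e (x + \sum_(c <- cs) c))%N.
  have : {subset cs <= cs} by [].
  elim: {1 3 4}cs x => [|c l IH] x lcs Sx.
    by rewrite !big_nil !addr0 addnC.
  have cc : c \in cs by apply: lcs; rewrite mem_head.
  have [_ Sxc _] := step x c Sx cc.
  have {}lcs : {subset l <= cs} by move=> y yl; apply: lcs; rewrite inE yl orbT.
  have := IH _ lcs Sxc; have := step1 x c Sx cc.
  rewrite !big_cons !addrA; set s1 := mult _ _ (_ + _ + _).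
  set s2 := mult _ _ (_ + _ + _); clearbody s1 s2; lia.
by have := chain 0 S0; rewrite !add0r sum0 (mult0 hp) (mult0 hq) addn0;
  apply: leq_trans; apply: leq_addr.
Qed.

End RankOne.

(** * The derivative polynomial *)

Section Derivative.
Context {R : realType} {V : vectType R}.
Local Notation d := (\dim {:V}).
Implicit Types (p q : {mpoly R[d]}) (e u v x y z : V) (a s t : R).

(** Gauss-Lucas for real roots: each term of P'/P at [w] is the inverse of [w + a],
    whose imaginary part has the sign opposite to that of [w]. *)
Lemma log_deriv_Im (rs : seq R) (w : R[i]) : complex.Im w != 0 ->
  let P := map_poly (real_complex R) (\prod_(a <- rs) ('X + a%:P)) in
  exists2 l : R[i], P^`().[w] = l * P.[w] &
    complex.Im w * complex.Im l <= 0 ?= iff (rs == [::]).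
Proof.
move=> w0 /=; elim: rs => [|a rs [l lE lIm]].
  by exists 0; rewrite ?big_nil ?rmorph1 ?derivC ?hornerC ?mul0r //= mulr0; split; rewrite ?eqxx.
rewrite big_cons rmorphM rmorphD /= map_polyX map_polyC /=.
set b := w + real_complex R a.
have b0 : b != 0.
  by rewrite /b; case: (w) w0 => x y /= y0; rewrite eq_complex /= addr0 (negPf y0) andbF.
exists (b^-1 + l).
  rewrite derivM derivD derivX derivC addr0 mul1r !hornerE /= lE -/b.
  rewrite [(_ + l) * b]mulrDl mulVf // [RHS]mulrDl mul1r; congr (_ + _); ring.
have bIm : complex.Im w * complex.Im b^-1 < 0.
  rewrite /b; case: (w) w0 => x y /= y0; rewrite addr0 mulrN oppr_lt0 mulrA.
  by rewrite divr_gt0 -?expr2 ?exprn_even_gt0 // ltr_wpDl ?sqr_ge0 // exprn_even_gt0.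
have sum_lt : complex.Im w * complex.Im (b^-1 + l) < 0.
  have -> : complex.Im (b^-1 + l) = complex.Im b^-1 + complex.Im l.
    by case: (b^-1) (l) => ? ? [].
  by rewrite mulrDr ltr_wnDr // lIm.
by split; rewrite ?ltW // lt_eqF.
Qed.

Lemma only_real_zeros_deriv (f : {poly R}) : only_real_zeros f -> (1 < size f)%N ->
  only_real_zeros f^`().
Proof.
move=> hf szf w fw; have [rs fE] := real_rooted_split hf.
have f0 : lead_coef f != 0.
  by rewrite lead_coef_eq0 -size_poly_gt0 (ltn_trans _ szf).
have rs0 : rs != [::].
  by apply: contraTneq szf => rs0; rewrite fE rs0 big_nil size_scale // size_poly1.
have [wr|w0] := eqVneq (complex.Im w) 0; first by case: w wr {fw} => x y /= ->; rewrite complex_real.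
have [l lE lIm] := log_deriv_Im rs w0.
move: fw; rewrite fE derivZ map_polyZ rootZ ?fmorph_eq0 // -deriv_map.
rewrite /root lE mulf_eq0 => /orP[/eqP l0|].
  by move: lIm => [_]; rewrite l0 mulr0 eqxx (negPf rs0).
move=> Pw; apply: hf; rewrite fE map_polyZ rootZ ?fmorph_eq0 //.
Qed.

Lemma deriv_prod_XaddC_gt0 (rs : seq R) t : rs != [::] ->
  (forall a, a \in rs -> 0 < t + a) ->
  0 < (\prod_(a <- rs) ('X + a%:P))^`().[t].
Proof.
elim: rs => [//|a rs IH] _ rsP; rewrite big_cons.
have ta := rsP a (mem_head _ _).
have {}rsP b : b \in rs -> 0 < t + b by move=> br; rewrite rsP // inE br orbT.
rewrite derivM derivD derivX derivC addr0 mul1r !hornerE /=.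
have P0 : 0 < (\prod_(a <- rs) ('X + a%:P)).[t].
  rewrite horner_prod big_seq; apply: prodr_gt0 => b /rsP; by rewrite !hornerE.
have [->|rs0] := eqVneq rs [::]; first by rewrite big_nil derivC !hornerE.
by rewrite addr_gt0 // mulr_gt0 // IH.
Qed.

(** In the expansion of p (T e + X) the coefficient of T^j is homogeneous of degree
    n - j in X, and the derivative polynomial is the coefficient of T. *)
Lemma deriv_poly_homog n p e : p \is n.-homog -> deriv_poly p e \is n.-1.-homog.
Proof.
pose P k (f : {poly {mpoly R[d]}}) :=
  (size f <= k.+1)%N /\ forall j, (j <= k)%N -> f`_j \is (k - j).-homog.
have PM k1 f1 k2 f2 : P k1 f1 -> P k2 f2 -> P (k1 + k2)%N (f1 * f2).
  case=> s1 h1 [s2 h2]; split.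
    rewrite (leq_trans (size_polyMleq _ _)) // -subn1 leq_subLR add1n -addSn -addnS.
    exact: leq_add.
  move=> j jk; rewrite coefM; apply: rpred_sum => i _.
  have [ki|ki] := ltnP k1 i; first by rewrite [f1`_i]nth_default ?mul0r ?rpred0 // (leq_trans s1).
  have [kj|kj] := ltnP k2 (j - i).
    by rewrite [f2`_ _]nth_default ?mulr0 ?rpred0 // (leq_trans s2).
  have ij : (i <= j)%N by rewrite -ltnS.
  have -> : (k1 + k2 - j = (k1 - i) + (k2 - (j - i)))%N by lia.
  by apply: dhomogM; [apply: h1|apply: h2].
have homC a : (a%:MP : {mpoly R[d]}) \is 0.-homog.
  by rewrite -[_%:MP]mulr1 mul_mpolyC; apply: dhomogZ; apply: dhomog1.
have P0 (r : {mpoly R[d]}) : r \is 0.-homog -> P 0%N r%:P.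
  move=> r0; split=> [|j]; first exact: size_polyC_leq1.
  by rewrite leqn0 => /eqP ->; rewrite coefC.
have PX i k : P k ((((vcoord e i)%:MP *: 'X + ('X_i)%:P) : {poly {mpoly R[d]}}) ^+ k).
  elim: k => [|k IH]; first by rewrite expr0 -polyC1; apply: (P0); exact: dhomog1.
  rewrite exprS -add1n; apply: (PM) => //; split.
    rewrite (leq_trans (size_polyD _ _)) // geq_max (leq_trans (size_scale_leq _ _)) ?size_polyX //.
    by rewrite (leq_trans (size_polyC_leq1 _)).
  move=> [|[|//]] _; rewrite coefD coefZ coefX coefC /= ?mulr0 ?add0r ?mulr1 ?addr0.
    by rewrite dhomogX /= mdeg1.
  exact: homC.
move=> /dhomogP hp; rewrite /deriv_poly horner_coef0 coef_deriv mulr1n.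
rewrite /mmap coef_sum big_seq; apply: rpred_sum => m mp.
have mn : mdeg m = n by exact: hp.
suff [sz H] : P n ((p@_m)%:MP%:P *
    mmap1 (fun i => (vcoord e i)%:MP *: 'X + ('X_i)%:P) m).
  case: n H sz {hp mn} => [|n'] H sz; last by have := H 1%N isT; rewrite subn1.
  by rewrite nth_default ?rpred0.
rewrite -mn -[mdeg m]add0n; apply: (PM); first exact: P0 (homC _).
rewrite mdegE /mmap1; apply: (big_rec2 (fun k f => P k f)) => [|i k f _ IH].
  by rewrite -polyC1; apply: (P0); exact: dhomog1.
exact: PM.
Qed.

Lemma pline_translate p e v t : pline p e (t *: e + v) = pline p e v \Po ('X + t%:P).
Proof.
apply: poly_ext => s; rewrite horner_comp !hornerE !horner_pline addrA.
by rewrite -scalerDl.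
Qed.

Lemma pline_deriv p e v : pline (deriv_poly p e) e v = (pline p e v)^`().
Proof.
apply: poly_ext => t; rewrite horner_pline pval_deriv_poly pline_translate.
by rewrite deriv_comp derivD derivX derivC addr0 mulr1 horner_comp !hornerE.
Qed.

Lemma hyperbolic_deriv n p e : hyperbolic n p e -> (2 <= n)%N ->
  hyperbolic n.-1 (deriv_poly p e) e.
Proof.
move=> hp n2; have [e0 n0 hh pe rz] := hp; split => //.
- by rewrite -ltnS prednK.
- exact: deriv_poly_homog.
- rewrite -(coef_pline e 0 (deriv_poly_homog e hh)) pline_deriv coef_deriv.
  by rewrite prednK // (coef_pline _ _ hh) mulrn_eq0 negb_or pe -lt0n n0.
- move=> x; rewrite pline_deriv; apply: only_real_zeros_deriv => //.
  by have [-> _] := lead_coef_pline (- x) hh pe.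
Qed.

(** The entries of [rs] are the eigenvalues of [x]. *)
Lemma pline_cone_split n p e x : hyperbolic n p e -> nonvanishing_cone p e x ->
  exists2 rs : seq R, pline p e x = pval p e *: \prod_(a <- rs) ('X + a%:P) &
    (forall a, a \in rs -> 0 <= a) /\ size rs = n.
Proof.
move=> hp Kx; have [_ _ hh pe _] := hp.
have [rs fE] := real_rooted_split (@only_real_zeros_pline _ _ n p e hp x).
have [sz lf] := lead_coef_pline x hh pe.
rewrite lf in fE; exists rs => //; split.
  move=> a ars; rewrite leNgt; apply/negP => a0.
  have /Kx : 0 < - a by rewrite oppr_gt0.
  have : root (pline p e x) (- a) by rewrite fE rootZ // root_prod_XaddC opprK.
  by rewrite /root horner_pline => ->.
move: sz; rewrite fE size_scale //.
under eq_bigr do rewrite -[X in 'X + X]opprK -polyCN.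
by rewrite -(big_map -%R xpredT (fun a => 'X - a%:P)) size_prod_XsubC size_map => -[].
Qed.

(** On the cone t |-> p (t e + x) is a product of factors t + a with a >= 0, and
    for t > 0 its logarithmic derivative is a sum of positive terms. *)
Lemma cone_sub_deriv n p e : hyperbolic n p e -> (2 <= n)%N ->
  nonvanishing_cone p e `<=` nonvanishing_cone (deriv_poly p e) e.
Proof.
move=> hp n2 x Kx t t0; rewrite -horner_pline pline_deriv.
have [rs -> [rs0 szrs]] := pline_cone_split hp Kx.
have pe : pval p e != 0 by case: hp.
rewrite derivZ hornerZ mulf_neq0 // gt_eqF // deriv_prod_XaddC_gt0 //.
  by rewrite -size_eq0 szrs; case: (n) n2.
by move=> a ars; rewrite ltr_wpDr // rs0.
Qed.

(** At a nonzero multiplicity differentiation lowers it by one.  Otherwise all the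
    roots are negative and the derivative cannot vanish at 0: its ratio to the
    polynomial there is a sum of positive terms. *)
Lemma mult_deriv n p e x : hyperbolic n p e -> (2 <= n)%N ->
  nonvanishing_cone p e x -> mult (deriv_poly p e) e x = (mult p e x).-1.
Proof.
move=> hp n2 Kx; have pe : pval p e != 0 by case: hp.
have [rx|rx] := boolP (root (pline p e x) 0).
  by rewrite /mult pline_deriv mu_deriv // subn1.
rewrite [in RHS]/mult (muNroot rx) /=.
apply: mult_eq0; have [rs fE [rs0 szrs]] := pline_cone_split hp Kx.
rewrite pval_deriv_poly fE derivZ hornerZ mulf_neq0 // gt_eqF //.
rewrite deriv_prod_XaddC_gt0 //; first by rewrite -size_eq0 szrs; case: (n) n2.
move=> a ars; rewrite add0r lt0r rs0 // andbT; apply: contra rx => /eqP a0.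
by rewrite fE rootZ // root_prod_XaddC oppr0 -a0.
Qed.

End Derivative.

(** * From eigenvalue lists to roots *)

Section Eigenvalues.
Context {R : realType} {V : vectType R}.
Local Notation d := (\dim {:V}).
Implicit Types (p q : {mpoly R[d]}) (e u v x y z : V) (a s t : R).

Lemma mu_prod_XsubC (rs : seq R) a :
  \mu_a (\prod_(b <- rs) ('X - b%:P)) = count_mem a rs.
Proof.
elim: rs => [|b rs IH]; first by rewrite big_nil -polyC1 mu_polyC.
rewrite big_cons mu_mul ?mulf_neq0 ?polyXsubC_eq0 ?monic_neq0 ?monic_prod_XsubC //.
rewrite IH /=; congr (_ + _)%N; have [->|ba] := eqVneq b a; first exact: mu_XsubC.
by rewrite muNroot // root_XsubC eq_sym.
Qed.

(** Both lists contain each [a] with its multiplicity as a root. *)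
Lemma perm_sorted_roots c (rs : seq R) : c != 0 ->
  perm_eq (sorted_roots (c *: \prod_(a <- rs) ('X - a%:P))) rs.
Proof.
move=> c0; set f := _ *: _.
have f0 : f != 0 by rewrite scaler_eq0 negb_or c0 monic_neq0 // monic_prod_XsubC.
have muE a : \mu_a f = count_mem a rs by rewrite mu_mulC // mu_prod_XsubC.
rewrite /sorted_roots perm_sort; apply/allP => a _ /=.
rewrite -muE count_flatten -map_comp sumnE big_map.
under eq_bigr do rewrite /= count_nseq.
have [ain|anin] := boolP (a \in rootsR f).
  rewrite (bigD1_seq a) ?uniq_roots //= eqxx mul1n big1 ?addn0 //.
  by move=> b ba; rewrite (negPf ba) mul0n.
rewrite big_seq big1 => [|b bin]; last first.
  rewrite /=; have /negPf -> : b != a by apply: contraNneq anin => <-.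
  by rewrite mul0n.
apply/eqP; rewrite muNroot //; apply: contra anin => fa.
by rewrite -(roots_on_rootsR f0) fa.
Qed.

(** The eigenvalues are the roots of p (t e - x); homogeneity turns them into the
    opposites of the roots of p (t e + x). *)
Lemma pline_eigenvalues n p e x : hyperbolic n p e ->
  pline p e x = pval p e *: \prod_(a <- sorted_roots (pline p e (- x))) ('X + a%:P) /\
  size (sorted_roots (pline p e (- x))) = n.
Proof.
move=> hp; have [_ _ hh pe _] := hp.
have [rs fE] := real_rooted_split (@only_real_zeros_pline _ _ n p e hp (- x)).
have [sz lf] := lead_coef_pline (- x) hh pe; rewrite lf in fE.
have fE' : pline p e (- x) = pval p e *: \prod_(a <- [seq - a | a <- rs]) ('X - a%:P).
  by rewrite fE big_map; under [in RHS]eq_bigr do rewrite polyCN opprK.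
have szrs : size rs = n.
  by move: sz; rewrite fE' size_scale // size_prod_XsubC size_map => -[].
have pm : perm_eq (sorted_roots (pline p e (- x))) [seq - a | a <- rs].
  by rewrite fE'; apply: perm_sorted_roots.
split; last by rewrite (perm_size pm) size_map.
rewrite (perm_big _ pm) big_map /=; apply: poly_ext => t.
rewrite horner_pline -[_ + x]opprK opprD -scaleNr -scaleN1r (pvalZ _ _ hh).
rewrite -horner_pline fE !hornerZ mulrCA; congr (_ * _).
rewrite -szrs; elim: rs {fE fE' szrs pm} => [|a rs IH].
  by rewrite !big_nil expr0 !hornerE.
rewrite !big_cons !hornerM -IH !hornerD !hornerX !hornerC exprS mulrACA.
by congr (_ * _); ring.
Qed.

Lemma hyp_coneE n p e : hyperbolic n p e -> hyp_cone n p e = nonvanishing_cone p e.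
Proof.
move=> hp; have pe : pval p e != 0 by case: hp.
apply/seteqP; split=> x Kx.
  move=> t t0; rewrite -horner_pline; have [-> sz] := pline_eigenvalues x hp.
  set s := sorted_roots _ in sz *; rewrite hornerZ mulf_neq0 // -/(root _ _).
  rewrite root_prod_XaddC; apply/negP => ts.
  have ilt : (index (- t) s < n)%N by rewrite -sz index_mem.
  have := Kx (Ordinal ilt); rewrite mxE /= -/s nth_index //.
  by rewrite oppr_ge0 leNgt t0.
move=> i; rewrite mxE; have [fE sz] := pline_eigenvalues x hp.
set s := sorted_roots _ in fE sz *; rewrite leNgt; apply/negP => s0.
have /Kx : 0 < - s`_i by rewrite oppr_gt0.
rewrite -horner_pline fE hornerZ mulf_eq0 (negPf pe) /= -/(root _ _).
by rewrite root_prod_XaddC opprK mem_nth // sz.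
Qed.

Lemma mult_hyp_cone_int n p e x : hyperbolic n p e -> hyp_cone_int n p e x ->
  mult p e x = 0%N.
Proof.
move=> hp Kx; have pe : pval p e != 0 by case: hp.
have [fE sz] := pline_eigenvalues x hp; rewrite /mult fE mu_mulC // muNroot //.
rewrite root_prod_XaddC oppr0; apply/negP => s0.
have ilt := s0; rewrite -index_mem sz in ilt.
by have := Kx (Ordinal ilt); rewrite mxE /= nth_index // ltxx.
Qed.

Lemma mult_rank_one n p e x : hyperbolic n p e -> rank_one n p e x ->
  mult p e x = n.-1.
Proof.
move=> hp; have pe : pval p e != 0 by case: hp.
have [fE sz] := pline_eigenvalues x hp; rewrite /rank_one /mult fE mu_mulC //.
set s := sorted_roots _ in sz *.
under eq_bigr do rewrite -[X in 'X + X]opprK -polyCN.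
rewrite -(big_map -%R xpredT (fun a => 'X - a%:P)) mu_prod_XsubC count_map.
have -> : #|[set i : 'I_n | eigenvalue_map n p e x i 0 != 0]%SET| =
    count (predC (pred1 0)) s.
  rewrite -sum1_count (big_nth 0) sz big_mkord -sum1dep_card.
  by apply: eq_bigl => i; rewrite mxE.
move=> c1; rewrite -sz -(count_predC (pred1 0) s) c1 addn1 /=.
by apply: eq_count => a /=; rewrite oppr_eq0.
Qed.

End Eigenvalues.

(** * Minimality of the polynomial and of its derivative *)

Theorem theorem3p12 (R : realType) (V : vectType R) (n : nat)
    (p : {mpoly R[\dim {:V}]}) (e : V) (hp : hyperbolic n p e)
    (k : nat) (c : 'I_k -> V)
    (c_cone : forall i, hyp_cone n p e (c i))
    (c_rank1 : forall i, rank_one n p e (c i))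
    (c_sum : hyp_cone_int n p e (\sum_(i < k) c i)) :
  minimal_poly n p e /\
  ((2 <= n)%N ->
     minimal_poly n.-1 (deriv_poly p e) e /\
     hyp_cone n p e `<` hyp_cone n.-1 (deriv_poly p e) e).
Proof.
pose K := nonvanishing_cone p e; pose cs := [seq c i | i <- enum 'I_k].
have csE : \sum_(x <- cs) x = \sum_(i < k) c i by rewrite big_map big_enum.
have sum0 : mult p e (\sum_(x <- cs) x) = 0%N.
  by rewrite csE; apply: mult_hyp_cone_int c_sum.
have step x y : K x -> y \in cs ->
    [/\ K y, K (x + y) & (mult p e x <= (mult p e (x + y)).+1)%N].
  move=> Kx /mapP[i _ ->].
  have Ki : K (c i) by rewrite /K -(hyp_coneE hp).
  split; [exact: Ki|exact: (cone_addW hp)|apply: (mult_rank_one_step hp) => //].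
  by rewrite (mult_rank_one hp).
have p_min m q : hyperbolic m q e -> hyp_cone m q e = hyp_cone n p e -> (n <= m)%N.
  move=> hq; rewrite (hyp_coneE hq) (hyp_coneE hp) => Kqp.
  exact: (degree_le_of_chain hp hq Kqp _ (cone0 hp) step sum0).
split=> // n2; have hp' := hyperbolic_deriv hp n2.
have sub := cone_sub_deriv hp n2.
split; last first.
  split; first by rewrite (hyp_coneE hp) (hyp_coneE hp').
  move=> sub'; have := p_min _ _ hp'.
  have -> : hyp_cone n.-1 (deriv_poly p e) e = hyp_cone n p e.
    by apply/seteqP; split=> //; rewrite (hyp_coneE hp) (hyp_coneE hp').
  by move=> /(_ erefl); rewrite leqNgt prednK ?leqnn // ltnW.
split=> // m q hq; rewrite (hyp_coneE hq) (hyp_coneE hp') => Kqp.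
apply: (degree_le_of_chain (S := K) (cs := cs) hp' hq Kqp sub (cone0 hp)).
  move=> x y Kx ycs; have [Ky Kxy xy] := step x y Kx ycs; split=> //.
  by rewrite !(mult_deriv hp n2) //; lia.
rewrite (mult_deriv hp n2) ?sum0 // -/K.
suff: forall l, {subset l <= cs} -> K (\sum_(x <- l) x) by apply.
elim=> [|y l IH] lcs; first by rewrite big_nil; apply: cone0 hp.
have yl : y \in cs by apply: lcs; rewrite mem_head.
rewrite big_cons addrC; have [|//] := step _ y (IH _) yl.
by move=> x xl; apply: lcs; rewrite inE xl orbT.
Qed.
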